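(* Let $k\ge1$ be an integer. Then: 1) for every integer $\gamma\ge1$, $\rho(\gamma\mathbb{Z}^k)=1/\gamma^k$; 2) for all integers $\gamma\ge1$ and $r\ge\gamma$, $$\left|\rho_r(\gamma\mathbb{Z}^k)-\frac1{\gamma^k}\right|\le\frac{2^{k+1}k}{r\,\gamma^{k-1}};$$ 3) as $r\to\infty$, $\rho_r(\gamma\mathbb{Z}^k)$ converges to $1/\gamma^k$ uniformly in $\gamma\in\{1,2,3,\dots\}$.
   Context: $\gamma\mathbb{Z}^k=\{(\alpha_1,\dots,\alpha_k)\in\mathbb{Z}^k : \gamma \text{ divides each } \alpha_i\}$. For a nonnegative integer $r$, $B_r=\{(\alpha_1,\dots,\alpha_k)\in\mathbb{Z}^k:\max_i|\alpha_i|\le r\}$. For $S\subseteq\mathbb{Z}^k$, $\rho_r(S)=|S\cap B_r|/|B_r|$ and $\rho(S)=\lim_{r\to\infty}\rho_r(S)$ when the limit exists. *)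

(* Defs.v *)
From HB Require Import structures.
From mathcomp Require Import all_boot all_order all_algebra finmap.
From mathcomp Require Import all_classical all_reals all_analysis.
From mathcomp Require Import zify.
Set Implicit Arguments.
Unset Strict Implicit.
Unset Printing Implicit Defensive.
Import Order.TTheory GRing.Theory Num.Theory.
Import numFieldNormedType.Exports.
Local Open Scope classical_set_scope.
Local Open Scope ring_scope.

Definition sublattice (k gamma : nat) : set 'rV[int]_k :=
  [set a | forall i : 'I_k, (gamma%:Z %| a ord0 i)%Z].
Arguments sublattice : clear implicits.

Definition cube (k r : nat) : set 'rV[int]_k :=
  [set a | (\max_(i < k) `|a ord0 i| <= r)%N].
Arguments cube : clear implicits.

(* [fset_set] sends infinite sets to the empty set; the sets counted in
   [rho_at] are all finite by this lemma. *)
Lemma finite_cube (k r : nat) : finite_set (cube k r).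
Proof.
pose f (u : {ffun 'I_k -> 'I_(2 * r).+1}) : 'rV[int]_k :=
  \row_i ((u i : nat)%:Z - r%:Z).
apply: (@sub_finite_set _ _ (f @` [set: _])); last first.
  exact/finite_image/finite_finset.
move=> a /= /bigmax_leqP ha.
exists [ffun i => inord `|(a ord0 i + r%:Z)%R|%N] => //.
apply/rowP => i; rewrite mxE ffunE.
have := ha i isT; move: (a ord0 i) => x hx.
rewrite inordK; lia.
Qed.

Definition rho_at (R : realType) (k : nat) (S : set 'rV[int]_k) (r : nat) : R :=
  #|` fset_set (S `&` cube k r)|%:R / #|` fset_set (cube k r)|%:R.

(* [rho S] is the density of [S] only when [cvgn (rho_at R S)] holds. *)
Definition rho (R : realType) (k : nat) (S : set 'rV[int]_k) : R :=
  limn (rho_at R S).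

(* Main.v *)
(* The lattice points of [gamma Z^k] in the cube [B_r] form a grid of side
   [2 * (r %/ gamma) + 1], so [rho_r (gamma Z^k) = p ^+ k] with
   [p = (2 * (r %/ gamma) + 1) / (2 r + 1)].  Euclidean division of [r] by
   [gamma] gives [|p - 1 / gamma| <= 1 / (2 r + 1)], uniformly in [gamma], and
   the factorization of [x ^+ k - y ^+ k] transfers this to [k]-th powers:
   [p] and [1 / gamma] are at most [1] in general (which gives uniform
   convergence) and at most [2 / gamma] when [gamma <= r] (which gives the
   explicit bound). *)
Require Import Defs.
From HB Require Import structures.
From mathcomp Require Import all_boot all_order all_algebra finmap.
From mathcomp Require Import all_classical all_reals all_analysis.
From mathcomp Require Import zify ring lra.
Import Order.TTheory GRing.Theory Num.Theory.
Import numFieldNormedType.Exports.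
Local Open Scope classical_set_scope.
Local Open Scope ring_scope.

Lemma card_fset_set_range (T : finType) (U : choiceType) (f : T -> U) :
  injective f -> #|` fset_set (range f)| = #|T|.
Proof.
move=> f_inj; rewrite fset_set_image; last exact: finite_finset.
rewrite card_imfset //=.
have -> : fset_set [set: T] = [fset x in T]%fset.
  apply/fsetP => x; rewrite in_fset_set; last exact: finite_finset.
  by rewrite !inE; apply/mem_set.
by rewrite card_imfset //= cardE enumT.
Qed.

Lemma card_sublattice_cube (k gamma r : nat) : (1 <= gamma)%N ->
  #|` fset_set (sublattice k gamma `&` cube k r)|
    = ((2 * (r %/ gamma)).+1 ^ k)%N.
Proof.
move=> gamma_gt0; set m := (r %/ gamma)%N.
(* Shifting by [m] moves the range [0..2m] of an ordinal to [-m..m]; scaling by [gamma] then gives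
   the grid coordinates. *)
pose f (u : {ffun 'I_k -> 'I_(2 * m).+1}) : 'rV[int]_k :=
  \row_i (((u i : nat)%:Z - m%:Z) * gamma%:Z).
have f_inj : injective f.
  move=> u v /rowP uv; apply/ffunP => i; apply/val_inj => /=.
  by have := uv i; rewrite !mxE; nia.
have -> : sublattice k gamma `&` cube k r = range f.
  apply/seteqP; split=> [a /= [da /bigmax_leqP ra]|a /= [u _ <-]].
    (* Each exact quotient [q] has absolute value at most [m], so [q + m] lies in [0..2m], where the
       absolute value and [inord] change nothing. *)
    exists [ffun i => inord `|((a ord0 i %/ gamma%:Z)%Z + m%:Z)%R|%N] => //.
    apply/rowP => i; rewrite mxE ffunE.
    have /= := ra i isT; have := divzK (da i).
    move: (a ord0 i) (_ %/ _)%Z => x q <- le_r.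
    have qm : (`|q| <= m)%N by rewrite leq_divRL //; nia.
    rewrite inordK; nia.
  split=> [i|]; first by rewrite mxE dvdz_mull.
  apply/bigmax_leqP => i _; rewrite mxE.
  have := leq_trunc_div r gamma; rewrite -/m; have := ltn_ord (u i).
  move: (nat_of_ord (u i)) => n; nia.
by rewrite card_fset_set_range // card_ffun !card_ord.
Qed.

Lemma card_cube (k r : nat) : #|` fset_set (cube k r)| = ((2 * r).+1 ^ k)%N.
Proof.
(* The full cube is the case [gamma = 1]. *)
rewrite -[in RHS](divn1 r) -card_sublattice_cube //; congr (#|` fset_set _|).
by apply/seteqP; split=> [a ra|a []//]; split=> // i; rewrite dvd1z.
Qed.

Lemma rho_at_sublattice (R : realType) (k gamma r : nat) : (1 <= gamma)%N ->
  rho_at R (sublattice k gamma) r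
    = ((2 * (r %/ gamma)).+1%:R / (2 * r).+1%:R) ^+ k.
Proof.
by move=> ?; rewrite /rho_at card_sublattice_cube // card_cube expr_div_n !natrX.
Qed.

(** The cofactor of [x - y] in [x ^+ n - y ^+ n] is a sum of [n] monomials of degree [n.-1] in [x]
    and [y], each of norm at most [c ^+ n.-1]. *)
Lemma ler_distX (R : numDomainType) (c x y : R) (n : nat) :
  `|x| <= c -> `|y| <= c ->
  `|x ^+ n - y ^+ n| <= `|x - y| * (c ^+ n.-1 *+ n).
Proof.
move=> xc yc; rewrite subrXX normrM ler_wpM2l //.
apply: le_trans (ler_norm_sum _ _ _) _.
have -> : c ^+ n.-1 *+ n = \sum_(i < n) c ^+ n.-1 by rewrite sumr_const card_ord.
apply: ler_sum => i _.
rewrite -[in leRHS](@subnK i n.-1); last by have := ltn_ord i; lia.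
rewrite exprD normrM !normrX.
by rewrite ler_pM ?exprn_ge0 // lerXn2r ?nnegrE // (le_trans _ xc).
Qed.

(** With [s] the remainder of [r] modulo [gamma], the numerator [a * g - d] equals
    [gamma - 2 s - 1], whose absolute value is below [gamma]. *)
Lemma dist_grid_ratio (R : realFieldType) (gamma r : nat) : (1 <= gamma)%N ->
  `|(2 * (r %/ gamma)).+1%:R / (2 * r).+1%:R - 1 / gamma%:R|
    <= (2 * r).+1%:R^-1 :> R.
Proof.
move=> gamma_gt0.
have g0 : 0 < gamma%:R :> R by rewrite ltr0n.
have d0 : 0 < (2 * r).+1%:R :> R by rewrite ltr0n.
set a : R := (_.+1)%:R; set d : R := (_.+1)%:R; set g : R := gamma%:R.
have -> : a / d - 1 / g = (a * g - d) / g / d.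
  by field; rewrite !gt_eqF.
have := ltn_mod r gamma; rewrite gamma_gt0 => lt_s.
have := divn_eq r gamma; move: (r %% gamma)%N lt_s => s lt_s r_eq.
have le1 : a * g <= d + g by rewrite -natrM -natrD ler_nat; nia.
have le2 : d <= a * g + g by rewrite -natrM -natrD ler_nat; nia.
rewrite normrM (gtr0_norm (_ : 0 < d^-1)) ?invr_gt0 //.
rewrite ler_piMl ?invr_ge0 ?(ltW d0) //.
rewrite normrM (gtr0_norm (_ : 0 < g^-1)) ?invr_gt0 //.
rewrite ler_pdivrMr // mul1r ler_norml; lra.
Qed.

Lemma dist_rho_at_sublattice (R : realType) (k gamma r : nat) :
  (1 <= gamma)%N ->
  `|rho_at R (sublattice k gamma) r - 1 / gamma%:R ^+ k|
    <= k%:R * (2 * r).+1%:R^-1.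
Proof.
move=> gamma_gt0; rewrite rho_at_sublattice //.
have -> : 1 / gamma%:R ^+ k = (1 / gamma%:R) ^+ k :> R
  by rewrite expr_div_n expr1n.
apply: le_trans (ler_distX _ 1 _ _ _ _ _) _.
- rewrite ger0_norm ?divr_ge0 // ler_pdivrMr ?ltr0n // mul1r ler_nat ltnS.
  by rewrite leq_mul2l leq_div.
- by rewrite ger0_norm ?divr_ge0 // ler_pdivrMr ?ltr0n // mul1r ler1n.
by rewrite expr1n mulrC ler_wpM2l // dist_grid_ratio.
Qed.

Lemma near_dist_rho_at_sublattice (R : realType) (k : nat) (e : R) : 0 < e ->
  \forall r \near \oo, forall gamma : nat, (1 <= gamma)%N ->
    `|rho_at R (sublattice k gamma) r - 1 / gamma%:R ^+ k| < e.
Proof.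
move=> e_gt0.
(* [k.+1] keeps the divisor positive even for [k = 0]; the bound [k / (2 r + 1)] is at most
   [k.+1 / r.+1]. *)
have e'_gt0 : 0 < e / k.+1%:R by rewrite divr_gt0.
near=> r => gamma gamma_gt0.
apply: le_lt_trans (dist_rho_at_sublattice _ _ _ _ gamma_gt0) _.
have : r.+1%:R^-1 < e / k.+1%:R.
  by near: r; exact: (near_infty_natSinv_lt (PosNum e'_gt0)).
rewrite ltr_pdivlMr // mulrC; apply: le_lt_trans.
by rewrite ler_pM ?ler_nat // lef_pV2 ?posrE // ler_nat; lia.
Unshelve. all: by end_near. Qed.

Theorem proposition2p4 (R : realType) (k : nat) (hk : (1 <= k)%N) :
  [/\ forall gamma : nat, (1 <= gamma)%N ->
        cvgn (rho_at R (sublattice k gamma)) /\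
        rho R (sublattice k gamma) = 1 / gamma%:R ^+ k,
      forall gamma r : nat, (1 <= gamma)%N -> (gamma <= r)%N ->
        `|rho_at R (sublattice k gamma) r - 1 / gamma%:R ^+ k|
          <= (2 ^+ k.+1 * k%:R) / (r%:R * gamma%:R ^+ k.-1)
    & {uniform [set gamma : nat | (1 <= gamma)%N],
        (fun r gamma : nat => rho_at R (sublattice k gamma) r) @ \oo -->
        (fun gamma : nat => 1 / gamma%:R ^+ k : R)}].
Proof.
split.
- move=> gamma gamma_gt0.
  have cv : rho_at R (sublattice k gamma) @ \oo --> (1 / gamma%:R ^+ k : R).
    apply/cvgrPdist_lt => e /(near_dist_rho_at_sublattice _ k); apply: filterS.
    by move=> r /(_ _ gamma_gt0); rewrite distrC.
  by split; [apply/cvg_ex; exists (1 / gamma%:R ^+ k : R) | exact/cvg_lim].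
- move=> gamma r gamma_gt0 le_gr.
  have g0 : 0 < gamma%:R :> R by rewrite ltr0n.
  have r_gt0 : (0 < r)%N by exact: leq_trans le_gr.
  rewrite rho_at_sublattice //.
  have -> : 1 / gamma%:R ^+ k = (1 / gamma%:R) ^+ k :> R
    by rewrite expr_div_n expr1n.
  (* For [gamma <= r], [(2 (r %/ gamma) + 1) gamma <= 2 r + gamma <= 2 (2 r + 1)], so both bases are
     at most [2 / gamma]. *)
  apply: le_trans (ler_distX _ (2 / gamma%:R) _ _ _ _ _) _.
  + rewrite ger0_norm ?divr_ge0 // ler_pdivrMr ?ltr0n // mulrAC.
    rewrite ler_pdivlMr // -!natrM ler_nat.
    by have := leq_trunc_div r gamma; nia.
  + by rewrite ger0_norm ?divr_ge0 // ler_pM2r ?invr_gt0 // ler1n.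
  rewrite -(mulr_natr _ k) expr_div_n mulrA.
  have le_r : `|(2 * (r %/ gamma)).+1%:R / (2 * r).+1%:R - 1 / gamma%:R|
      <= r%:R^-1 :> R.
    apply: le_trans (dist_grid_ratio _ _ _ gamma_gt0) _.
    by rewrite lef_pV2 ?posrE ?ltr0n // ler_nat; lia.
  have -> : 2 ^+ k.+1 * k%:R / (r%:R * gamma%:R ^+ k.-1)
      = r%:R^-1 * (2 ^+ k.+1 / gamma%:R ^+ k.-1) * k%:R :> R.
    by rewrite invfM; ring.
  (* The argument yields the constant [2 ^+ k.-1], which is weakened to [2 ^+ k.+1]. *)
  rewrite ler_wpM2r // ler_pM ?divr_ge0 ?exprn_ge0 //.
  rewrite ler_pM2r ?invr_gt0 ?exprn_gt0 // ler_eXn2l ?ltr1n //.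
  lia.
(* A uniform neighborhood contains all functions [E]-close to the limit at every [gamma >= 1]; [E]
   contains a metric [e]-band, and the rank from which [r] works is common to all [gamma]. *)
- move=> P /uniform_nbhs [E [entE sub_P]].
  have [e e_gt0 sub_E] : exists2 e : R, 0 < e &
      forall x y, `|x - y| < e -> E (x, y).
    move: entE; rewrite -(entourage_from_ballE (R := R)) => -[e e_gt0 sub_E].
    by exists e => // x y xy; exact: sub_E.
  apply: filterS (near_dist_rho_at_sublattice _ k _ e_gt0) => r near_r.
  apply: sub_P => gamma gamma_gt0; apply: sub_E.
  by rewrite distrC near_r.
Qed.
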